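(* Let $L:=\inf\{a\in\mathbb{R}_+:\exists k\in K\text{ such that }(a,k)\in\mathcal{T}\}$ and assume $\sup_{k\in K}\theta_k^*\le L\in(0,\infty)$. For $t\in[L,\infty)$ let $\phi_t(\cdot)=(\cdot-t)_+$ and $$J[\phi_t]=\int_{\mathcal{T}_+}[(\phi_t)'_+(a)(a-\xi_k)-\phi_t(a)]\,\mathbb{Q}(da\times dk)+\int_{\mathcal{T}_-}[(\phi_t)'_-(a)(a-\xi_k)-\phi_t(a)]\,\mathbb{Q}(da\times dk),$$ where $\mathcal{T}_+:=\{(a,k)\in\mathcal{T}:a\ge\xi_k\}$ and $\mathcal{T}_-:=\{(a,k)\in\mathcal{T}:a<\xi_k\}$, and let $\tau^*:=\arg\max_{t\in[L,\infty)}J[\phi_t]$. For the problem of maximizing $$J[M]=\int\{\lambda_{(a,k)}[(a-d_{(a,k)})_+-H[(X_k-d_{(a,k)})_+]]-v(a)\}\,\mathbb{Q}(da\times dk)$$ over all feasible change-loss menus $M=\{v,\lambda_{(a,k)},d_{(a,k)}\}\in\mathcal{M}_3$, the optimal coinsurance rates $\lambda^*_{(a,k)}$, the optimal deductibles $d^*_{(a,k)}$, and the optimal premiums $P^*_{(a,k)}$ are given respectively by $$\lambda^*_{(a,k)}=\begin{cases}1, & \text{if }a>\tau^*;\\ 1, & \text{if }a=\tau^*\ge\xi_k;\\ 0, & \text{if }a=\tau^*<\xi_k;\\ 0, & \text{if }a<\tau^*,\end{cases}\qquad d^*_{(a,k)}=\begin{cases}\theta_k^*, & \text{if }a\ge\tau^*;\\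 \text{irrelevant (any value)}, & \text{if }a<\tau^*,\end{cases}$$ and, with $v^*=\phi_{\tau^*}$, $$P^*_{(a,k)}=\lambda^*_{(a,k)}(a-d^*_{(a,k)})_+-v^*(a)=\begin{cases}\tau^*-\theta_k^*, & \text{if }a>\tau^*;\\ \tau^*-\theta_k^*, & \text{if }a=\tau^*\ge\xi_k;\\ 0, & \text{if }a=\tau^*<\xi_k;\\ 0, & \text{if }a<\tau^*.\end{cases}$$
   Context: Setting. $\mathbb{R}_+=[0,\infty)$, $\overline{\mathbb{R}}_+=[0,\infty]$, $(x-\infty)_+=0$. $K$ is a Polish space with its Borel $\sigma$-algebra. For each $k\in K$, $X_k$ is a nonnegative random variable (loss) with distribution function $F_k$ that is strictly increasing and continuous on its support, with possibly a jump at $0$; $\overline{F}_k=1-F_k$. $\tilde{\mathcal{T}}\subset(0,1)\times K$ is a measurable set whose projection onto $K$ is all of $K$, with $\alpha<1-F_k(0)$ for all $(\alpha,k)\in\tilde{\mathcal{T}}$, and $\mathrm{VaR}_\alpha(X_k)=\overline{F}_k^{-1}(\alpha)$. The (injective) map $\iota(\alpha,k)=(\mathrm{VaR}_\alpha(X_k),k)$ from $\tilde{\mathcal{T}}$ to $\mathbb{R}_+\times K$ is assumed measurable; $\mathcal{T}:=\iota(\tilde{\mathcal{T}})$ is the (measurable) set of types $(a,k)$. $\tilde{\mathbb{Q}}$ is a probability measure on $\tilde{\mathcal{T}}$ and $\mathbb{Q}=\tilde{\mathbb{Q}}\circ\iota^{-1}$ is its image on $\mathbb{R}_+\times K$, so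 $\mathbb{Q}$ is concentrated on $\mathcal{T}$. $H:\mathcal{X}\to\mathbb{R}$ is a cost functional on a domain $\mathcal{X}$ of random variables containing all $X_k$ (and the transforms of them to which $H$ is applied); $H$ is monotone, convex, comonotonic additive, satisfies $H[X]\ge 0$ for nonnegative $X$ with $H[X]=0$ only if $X=0$ a.s., and $H[1]=1+\theta>1$. For $k\in K$, the function $B_{X_k}(d):=-d-H[(X_k-d)_+]$ is concave on $\mathbb{R}_+$; $\theta_k^*$ denotes the point where $B_{X_k}$ attains its maximum ($\theta_k^*=+\infty$ if $B_{X_k}$ is increasing on all of $\mathbb{R}_+$), and $\xi_k:=-B_{X_k}(\theta_k^* )=\theta_k^*+H[(X_k-\theta_k^* )_+]$. Menus. $\mathcal{V}$ is the collection of all increasing (non-decreasing), convex, 1-Lipschitz functions on $\mathbb{R}_+$ that vanish at $0$; $v'_\pm$ denote one-sided derivatives, with $v'_-(0)=0$. $\mathcal{M}_3$ is the collection of feasible change-loss menus $M=\{v,\lambda_{(a,k)},d_{(a,k)}\}$: $v\in\mathcal{V}$ (indirect utility), $\lambda_{(a,k)}\in[0,1]$, $d_{(a,k)}\in\overline{\mathbb{R}}_+$ for $(a,k)\in\mathbb{R}_+\times K$ (the indemnity for type $(a,k)$ is $I_{(a,k)}(x)=\lambda_{(a,k)}(x-d_{(a,k)})_+$ and its premium is $P_{(a,k)}=I_{(a,k)}(a)-v(a)$), satisfying for every $(a,k)$ $$v(a')-v(a)\ge\lambda_{(a,k)}(a'-d_{(a,k)})_+-\lambda_{(a,k)}(a-d_{(a,k)})_+\quad\text{for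 any }a'\in\mathbb{R}_+.$$ Only menus for which the integrands are measurable and integrable are considered, so that the profit functionals are well-defined. The optimal menu has indirect utility $\phi_{\tau^*}$. ($\tau^*=\arg\max$ means that $\tau^*$ is a point at which the maximum is attained.) *)

(* Defs.v *)
From HB Require Import structures.
From mathcomp Require Import all_boot all_order all_algebra.
From mathcomp Require Import all_classical all_reals all_analysis.

Set Implicit Arguments.
Unset Strict Implicit.
Unset Printing Implicit Defensive.

Import Order.TTheory GRing.Theory Num.Theory.
Import numFieldNormedType.Exports.

Local Open Scope classical_set_scope.
Local Open Scope ring_scope.

(** ** Polish spaces *)

Definition polish (R : realType) (K : topologicalType) : Prop :=
  (exists2 D : set K, countable D & dense D) /\
  exists dist : K -> K -> R,
    [/\ forall x y, dist x y = 0 <-> x = y,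
        forall x y, dist x y = dist y x,
        forall x y z, dist x z <= dist x y + dist y z,
        forall (x : K) (A : set K),
          nbhs x A <-> exists2 e, 0 < e & [set y | dist x y < e] `<=` A
      & forall u : nat -> K,
          (forall e, 0 < e -> exists N : nat,
             forall m n : nat, (N <= m)%N -> (N <= n)%N -> dist (u m) (u n) < e) ->
          exists l : K, u @ \oo --> l].

Notation borel K := (g_sigma_algebraType (@open K)).

(** ** Real functions *)

Section RealFunctions.
Context {R : realType}.

Definition Rplus : set R := [set x | 0 <= x].

(* [excess x d] is (x - d)_+ for d in [0, +oo], with (x - oo)_+ = 0. *)
Definition excess (x : R) (d : \bar R) : R :=
  if d is r%:E then Num.max (x - r) 0 else 0.

Definition phi (t x : R) : R := Num.max (x - t) 0.

(* One-sided derivatives on [0, oo[, with the convention v'_-(0) = 0. *)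
Definition rderiv (v : R -> R) (a : R) : R :=
  lim ((v (a + h) - v a) / h @[h --> 0^'+]).

Definition lderiv (v : R -> R) (a : R) : R :=
  if a == 0 then 0 else lim ((v (a + h) - v a) / h @[h --> 0^'-]).

(* The class of indirect utilities; only the values on [0, oo[ matter. *)
Definition indirect_utilities (v : R -> R) : Prop :=
  [/\ v 0 = 0,
      {in Rplus &, {homo v : x y / x <= y}},
      convex_function (Rplus : set R^o) v
    & 1.-lipschitz_Rplus v].

End RealFunctions.

(** ** Losses and cost functional *)

Section Risk.
Context {R : realType} {dO : measure_display} {Omega : measurableType dO}
  (P : probability Omega R).

Definition rv_support (X : {RV P >-> R}) : set R :=
  [set x | forall e, 0 < e -> (0 < distribution P X `](x - e)%R, (x + e)%R[)%E].

(* A nonnegative loss whose distribution function is strictly increasing and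
   continuous on its support, except for a possible jump at 0. *)
Definition regular_loss (X : {RV P >-> R}) : Prop :=
  [/\ {ae P, forall w, 0 <= X w},
      forall x y, rv_support X x -> rv_support X y -> x < y ->
        (cdf X x < cdf X y)%E
    & forall x, rv_support X x -> x != 0 -> {for x, continuous (cdf X)}].

(* The (generalized) inverse of the survival function at alpha. *)
Definition VaR (alpha : R) (X : {RV P >-> R}) : R :=
  inf [set x | (ccdf X x <= alpha%:E)%E].

Definition comonotonic (X Y : Omega -> R) : Prop :=
  forall w w', 0 <= (X w - X w') * (Y w - Y w').

(* [dom] is the domain of [H].  Order relations and comonotonicity are pointwise,
   which asks less of [H] than their almost sure versions; [dom] is not assumed
   to be stable under the operations involved. *)
Record cost_functional (dom : set (Omega -> R)) (H : (Omega -> R) -> R)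
    (loading : R) : Prop := CostFunctional {
  cost_dom_measurable : forall X, dom X -> measurable_fun setT X;
  cost_monotone : forall X Y, dom X -> dom Y -> (forall w, X w <= Y w) ->
    H X <= H Y;
  cost_convex : forall X Y (l : R), dom X -> dom Y -> 0 <= l <= 1 ->
    dom (fun w => l * X w + (1 - l) * Y w) ->
    H (fun w => l * X w + (1 - l) * Y w) <= l * H X + (1 - l) * H Y;
  cost_comonotonic : forall X Y, dom X -> dom Y -> dom (fun w => X w + Y w) ->
    comonotonic X Y -> H (fun w => X w + Y w) = H X + H Y;
  cost_ge0 : forall X, dom X -> (forall w, 0 <= X w) -> 0 <= H X;
  cost_eq0 : forall X, dom X -> (forall w, 0 <= X w) -> H X = 0 ->
    {ae P, forall w, X w = 0};
  cost_loading : 0 < loading;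
  cost_dom1 : dom (cst 1);
  cost1 : H (cst 1) = 1 + loading
}.

Definition layer_value (H : (Omega -> R) -> R) (X : {RV P >-> R}) (d : R) : R :=
  - d - H (fun w => excess (X w) d%:E).

(* [t] is the point of [0, +oo] denoted theta^* for the function [B]. *)
Definition is_theta_star (B : R -> R) (t : \bar R) : Prop :=
  ({in Rplus &, {homo B : x y / x <= y}} /\ t = +oo%E) \/
  (~ {in Rplus &, {homo B : x y / x <= y}} /\
   exists2 r, t = r%:E & 0 <= r /\ forall d, 0 <= d -> B d <= B r).

End Risk.

(** ** Types and menus *)

Section Types.
Context {R : realType} {K : ptopologicalType}
  {dO : measure_display} {Omega : measurableType dO} {P : probability Omega R}
  (H : (Omega -> R) -> R) (X : K -> {RV P >-> R}).

(* Types (alpha, k), resp. (a, k); the first coordinate lives in ]0, 1[, resp.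
   [0, oo[, seen inside R. *)
Notation types := (R * borel K)%type.

Definition iota_type (z : types) : types := (VaR z.1 (X z.2), z.2).

Definition type_set (Tt : set types) : Prop :=
  [/\ measurable Tt,
      forall z, Tt z -> 0 < z.1 < 1,
      forall k, exists alpha, Tt (alpha, k),
      forall z, Tt z -> (z.1%:E < 1 - cdf (X z.2) 0)%E
    & measurable_fun Tt iota_type /\ measurable (iota_type @` Tt)].

(* [Q] is the image under [iota_type] of [Qt], a probability measure on [Tt]. *)
Definition image_law (Tt : set types) (Qt Q : probability types R) : Prop :=
  Qt Tt = 1%E /\
  forall A, measurable A -> Q A = Qt (Tt `&` iota_type @^-1` A).

Record menu := Menu {
  utility : R -> R;
  coinsurance : R -> K -> R;
  deductible : R -> K -> \bar R
}.

Definition indemnity (M : menu) (a : R) (k : K) (x : R) : R :=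
  coinsurance M a k * excess x (deductible M a k).

Definition premium (M : menu) (a : R) (k : K) : R :=
  indemnity M a k a - utility M a.

Definition feasible (M : menu) : Prop :=
  indirect_utilities (utility M) /\
  forall a k, 0 <= a ->
    [/\ 0 <= coinsurance M a k <= 1, (0 <= deductible M a k)%E
      & forall a', 0 <= a' ->
          utility M a' - utility M a >= indemnity M a k a' - indemnity M a k a].

Definition profit_density (M : menu) (z : types) : R :=
  coinsurance M z.1 z.2 *
    (excess z.1 (deductible M z.1 z.2)
     - H (fun w => excess (X z.2 w) (deductible M z.1 z.2)))
  - utility M z.1.

(* [T] is the set of types (a, k), on which [Q] is concentrated: integrating over
   [T] is integrating over [0, oo[ x K, and requires measurability on [T] only. *)
Context (Q : probability types R) (T : set types).

Definition menus3 (M : menu) : Prop :=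
  feasible M /\ Q.-integrable T (EFin \o profit_density M).

Definition profit (M : menu) : R := \int[Q]_(z in T) profit_density M z.

(* [fine] makes [xi] meaningless where [theta k = +oo]; the bound on
   sup_k theta_k in the theorem excludes this. *)
Context (theta : K -> \bar R).

Definition xi (k : K) : R := - layer_value H (X k) (fine (theta k)).

Definition types_plus : set types := [set z | T z /\ xi z.2 <= z.1].
Definition types_minus : set types := [set z | T z /\ z.1 < xi z.2].

Definition density_plus (v : R -> R) (z : types) : R :=
  rderiv v z.1 * (z.1 - xi z.2) - v z.1.
Definition density_minus (v : R -> R) (z : types) : R :=
  lderiv v z.1 * (z.1 - xi z.2) - v z.1.

Definition utility_profit (v : R -> R) : R :=
  \int[Q]_(z in types_plus) density_plus v z +
  \int[Q]_(z in types_minus) density_minus v z.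

Definition utility_profit_defined (v : R -> R) : Prop :=
  [/\ measurable types_plus, measurable types_minus,
      Q.-integrable types_plus (EFin \o density_plus v)
    & Q.-integrable types_minus (EFin \o density_minus v)].

Definition optimal_coinsurance (tau : R) (a : R) (k : K) : R :=
  if tau < a then 1
  else if a == tau then (if xi k <= tau then 1 else 0)
  else 0.

Definition optimal_premium (tau : R) (a : R) (k : K) : R :=
  if tau < a then tau - fine (theta k)
  else if a == tau then (if xi k <= tau then tau - fine (theta k) else 0)
  else 0.

End Types.

(* Main.v *)
Require Import Defs.
From HB Require Import structures.
From mathcomp Require Import all_boot all_order all_algebra.
From mathcomp Require Import all_classical all_reals all_analysis.
From mathcomp Require Import measurable_realfun ring lra.

Set Implicit Arguments.
Unset Strict Implicit.
Unset Printing Implicit Defensive.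

Import Order.TTheory GRing.Theory Num.Theory.
Import numFieldNormedType.Exports.

Local Open Scope classical_set_scope.
Local Open Scope ring_scope.

(* At a type (a, k) a feasible change-loss indemnity supplies a subgradient mu of
   the indirect utility v at a, and its profit there is at most
   mu (a - xi_k) - v(a).  Slicing the slopes of v into N equal levels approximates
   v from below by an average of N functions phi_t, where t is the kink of v at
   the given slope level; the profit densities of these phi_t average, up to
   O(1/N) pointwise, to at least mu (a - xi_k) - v(a).  Since all types lie above
   L, kinks below L may be moved to L.  Each phi_t has profit at most J[phi_tau],
   and all profit densities involved are bounded below by a single integrable
   function, so the bound passes to the limit even if a is not integrable. *)

(* Truncating [f_ n] at [f] makes dominated convergence apply without an
   integrable upper bound on the [f_ n]. *)
Lemma le_Rintegral_approx d (T : measurableType d) (R : realType)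
    (mu : measure T R) (D : set T) (f G : T -> R) (f_ : nat -> T -> R) (m : R) :
  measurable D ->
  mu.-integrable D (EFin \o f) -> mu.-integrable D (EFin \o G) ->
  (forall n, mu.-integrable D (EFin \o f_ n)) ->
  (forall n x, D x -> G x <= f_ n x) ->
  (forall x, D x -> exists c, forall n, f x <= f_ n x + c / n.+1%:R) ->
  (forall n, \int[mu]_(x in D) f_ n x <= m) ->
  \int[mu]_(x in D) f x <= m.
Proof.
move=> mD fi Gi f_i Gf_ ff_ f_m.
pose u n x : R := Num.min (f_ n x) (f x).
have mu_ n : measurable_fun D (u n).
  apply: measurable_minr; apply/measurable_EFinP.
  - exact: measurable_int (f_i n).
  - exact: measurable_int fi.
pose B x : R := `|f x| + `|G x|.
have Bi : mu.-integrable D (EFin \o B).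
  rewrite (_ : _ \o _ = (EFin \o (Num.norm \o f)) \+ (EFin \o (Num.norm \o G)))%E;
    last exact/funext.
  by apply: integrableD => //; apply: integrable_norm.
have uB n x : D x -> `|u n x| <= B x.
  move=> Dx; rewrite ler_norml /u /B le_min ge_min.
  have := Gf_ n x Dx; have := ler_norm (f x); have := ler_norm (- f x).
  have := ler_norm (- G x); rewrite !normrN.
  have := normr_ge0 (f x); have := normr_ge0 (G x).
  by move=> *; apply/andP; split; [apply/andP; split; lra|apply/orP; right; lra].
have ui n : mu.-integrable D (EFin \o u n).
  apply: le_integrable Bi => //; first exact/measurable_EFinP.
  by move=> x Dx /=; rewrite lee_fin (le_trans (uB n x Dx)) // ler_norm.
have ucv : (\int[mu]_(x in D) (u n x)%:E)%E @[n --> \oo] -->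
    (\int[mu]_(x in D) (f x)%:E)%E.
  apply: (@dominated_cvg _ _ _ mu D mD _ (EFin \o f) (EFin \o B)) => //.
  - by move=> n; exact/measurable_EFinP.
  - move=> x Dx; apply/cvg_EFin; first exact: nearW.
    have [c cf] := ff_ x Dx.
    (* [u n x] is squeezed between [f x - |c| / (n + 1)] and [f x]; the absolute value is there
       because [c] may be negative. *)
    have c0 : (f x - `|c| * n.+1%:R^-1) @[n --> \oo] --> f x.
      rewrite -[X in _ --> X]subr0; apply: cvgB; first exact: cvg_cst.
      rewrite -(mulr0 `|c|); apply: cvgM; first exact: cvg_cst.
      exact: cvg_harmonic.
    apply: squeeze_cvgr c0 (cvg_cst (f x)).
    apply: nearW => n; rewrite /u le_min ge_min lexx orbT andbT /=.
    have cc : c / n.+1%:R <= `|c| / n.+1%:R by rewrite ler_wpM2r // ler_norm.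
    have c1 : 0 <= `|c| / n.+1%:R by rewrite divr_ge0.
    have fcn := cf n.
    apply/andP; split; last by rewrite gerBl.
    by apply: (@le_trans _ _ (f x - c / n.+1%:R)); [rewrite lerD2l lerN2|rewrite lerBlDr].
rewrite -lee_fin /Rintegral fineK; last exact (integrable_fin_num mD fi).
apply: cvge_le ucv; apply: nearW => n.
have -> : (\int[mu]_(x in D) (u n x)%:E)%E = (\int[mu]_(x in D) u n x)%R%:E.
  by rewrite /Rintegral fineK //; exact (integrable_fin_num mD (ui n)).
rewrite lee_fin (le_trans _ (f_m n)) //; apply: le_Rintegral => // x Dx.
by rewrite /u ge_min lexx.
Qed.

(** * Slope levels and kinks of an indirect utility *)

Section Kinks.
Context {R : realType}.
Implicit Types (v : R -> R) (s a mu x : R).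

Definition subgradient v a mu := forall y, 0 <= y -> mu * (y - a) <= v y - v a.

(* The smallest point where the right slope of [v] is at least [s], or [+oo]. *)
Definition kink v s : \bar R :=
  ereal_inf (EFin @` [set x | 0 <= x /\
    forall y, x <= y -> s * (y - x) <= v y - v x]).

Lemma kink_ge0 v s : (0 <= kink v s)%E.
Proof. by apply: le_ereal_inf_tmp => _ [x [x0 _] <-]; rewrite lee_fin. Qed.

Lemma kink_homo v s s' : s <= s' -> (kink v s <= kink v s')%E.
Proof.
move=> ss'; apply: ereal_inf_le_tmp => _ [x [x0 xP] <-]; exists x => //; split => // y xy.
by apply: le_trans (xP y xy); rewrite ler_wpM2r // subr_ge0.
Qed.

Lemma kink_le v a mu s : 0 <= a -> subgradient v a mu -> s <= mu ->
  (kink v s <= a%:E)%E.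
Proof.
move=> a0 va smu; apply: ereal_inf_lbound; exists a => //; split=> // y ay.
by apply: le_trans (va y (le_trans a0 ay)); rewrite ler_wpM2r // subr_ge0.
Qed.

(** A point [x < a] of the set defining the kink gives s (a - x) <= v a - v x <= mu (a - x).
    Together with [kink_le], this locates [mu] among the slope levels; a kink exactly at [a] remains
    ambiguous. *)
Lemma kink_lt v a mu s : subgradient v a mu -> (kink v s < a%:E)%E -> s <= mu.
Proof.
move=> va /ereal_inf_lt[_ [x [x0 xP] <-]]; rewrite lte_fin => xa.
have ax : 0 < a - x by rewrite subr_gt0.
rewrite -(ler_pM2r ax); have := va x x0; have := xP a (ltW xa).
by move=> *; nra.
Qed.

(** Without continuity of [v] the infimum defining the kink need not be attained, so points [b] of
    the set slightly to the right of [t] are used, and monotonicity gives [v t <= v b]. *)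
Lemma kink_growth v s t x : {in Rplus &, {homo v : x y / x <= y}} -> 0 <= s ->
  kink v s = t%:E -> t <= x -> v t + s * (x - t) <= v x.
Proof.
move=> vh s0 kt; have t0 : 0 <= t by rewrite -lee_fin -kt kink_ge0.
rewrite le_eqVlt => /predU1P[<-|tx]; first by rewrite subrr mulr0 addr0.
apply/ler_addgt0Pl => e e0.
(* This distance makes s (b - t) <= e; the summand 1 covers [s = 0]. *)
pose r := Num.min x (t + e / (s + 1)).
have s1 : 0 < s + 1 by lra.
have tr : t < r by rewrite lt_min tx /= ltrDl divr_gt0.
have : (kink v s < r%:E)%E by rewrite kt lte_fin.
case/ereal_inf_lt => _ [b [b0 bP] <-]; rewrite lte_fin => br.
have tb : t <= b by rewrite -lee_fin -kt; apply: ereal_inf_lbound; exists b.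
have bx : b < x by apply: lt_le_trans br _; rewrite ge_min lexx.
have be : b < t + e / (s + 1) by apply: lt_le_trans br _; rewrite ge_min lexx orbT.
have vtb : v t <= v b by apply: vh => //; rewrite inE.
have := bP x (ltW bx).
have : s * (b - t) <= e.
  have : (s + 1) * (b - t) <= e by rewrite mulrC -ler_pdivlMr //; lra.
  have bt : 0 <= b - t by rewrite subr_ge0.
  by move=> ?; nra.
by move=> *; nra.
Qed.

(** Induction on the number of levels. Left of the last kink [t] its term vanishes. Right of [t] all
    n + 1 terms have slope 1/N, while [v] grows at rate at least (n + 1)/N by [kink_growth]; the
    induction hypothesis is applied at [t]. *)
Lemma sum_excess_kink_le v (N n : nat) x : (0 < N)%N -> v 0 = 0 ->
  {in Rplus &, {homo v : x y / x <= y}} -> 0 <= x ->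
  \sum_(i < n) excess x (kink v (i.+1%:R / N%:R)) / N%:R <= v x.
Proof.
move=> N0 v0 vh; elim: n x => [|n IH] x x0.
  by rewrite big_ord0 -{1}v0; apply: vh => //; rewrite inE /Rplus /=.
rewrite big_ord_recr /=.
case kt: (kink v (n.+1%:R / N%:R)) => [t||] /=; rewrite ?mul0r ?addr0; try exact: IH.
have t0 : 0 <= t by rewrite -lee_fin -kt kink_ge0.
have [xt|tx] := leP x t.
  by rewrite max_r ?mul0r ?addr0; [exact: IH|lra].
rewrite max_l; last lra.
apply: le_trans (kink_growth vh _ kt (ltW tx)); last by rewrite divr_ge0.
apply: le_trans (lerD (IH t t0) (lexx _)).
have -> : n.+1%:R / N%:R * (x - t) =
    \sum_(i < n) (x - t) / N%:R + (x - t) / N%:R.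
  by rewrite sumr_const card_ord -[((x - t) / _) *+ n]mulr_natl -natr1; ring.
rewrite addrA lerD2r -big_split /=; apply: ler_sum => i _.
have iN : i.+1%:R / N%:R <= n.+1%:R / N%:R :> R.
  by rewrite ler_wpM2r ?invr_ge0 // ler_nat ltnS ltnW.
have := kink_homo v iN; rewrite kt; have := kink_ge0 v (i.+1%:R / N%:R).
case: (kink v (i.+1%:R / N%:R)) => [r||] //= _; rewrite lee_fin => rt.
by rewrite !max_l; [rewrite -mulrDl ler_wpM2r ?invr_ge0 //; lra|lra|lra].
Qed.

(** The sum counts the integers from 1 to [N] that are at most [y]; for y <= N the cutoff at [N]
    loses none of them, so the count misses [y] by at most 1. *)
Lemma sum_le_count_ge (N : nat) (y : R) : y <= N%:R ->
  y - 1 <= \sum_(i < N) (i.+1%:R <= y)%R%:R.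
Proof.
elim: N => [|N IH] yN; first by rewrite big_ord0; lra.
have [yN'|Ny] := leP y N%:R.
  by rewrite big_ord_recr /= (le_trans (IH yN')) // lerDl.
rewrite big_ord_recr /= (eq_bigr (fun=> 1)) => [|i _]; last first.
  by rewrite (_ : i.+1%:R <= y) // (le_trans _ (ltW Ny)) // ler_nat.
have := ler0n R (N.+1%:R <= y)%R; rewrite sumr_const card_ord -natr1 in yN *.
by move=> ?; lra.
Qed.

Lemma sum_le_count_le (N : nat) (y : R) : 0 <= y ->
  \sum_(i < N) (i.+1%:R <= y)%R%:R <= y.
Proof.
move=> y0; elim: N => [|N IH]; first by rewrite big_ord0.
have [yN|Ny] := leP N.+1%:R y; last by rewrite big_ord_recr /= (lt_geF Ny) addr0.
apply: le_trans yN.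
have -> : N.+1%:R = \sum_(i < N.+1) (1 : R) by rewrite sumr_const card_ord.
by apply: ler_sum => i _; rewrite lern1 leq_b1.
Qed.

End Kinks.

(** * Pointwise profit densities of the functions [phi t] *)

Section PhiDensity.
Context {R : realType}.
Implicit Types (t : \bar R) (a x L mu : R) (v : R -> R).

Lemma rderiv_phi (r a : R) : rderiv (phi r) a = (r <= a)%R%:R.
Proof.
apply/cvg_lim => //; apply: cvg_near_cst.
have [ra|ar] := leP r a; near=> h.
- have h0 : 0 < h by near: h; exact: nbhs_right_gt.
  by rewrite /phi !max_l; [|lra|lra]; rewrite (_ : a + h - r - (a - r) = h) ?divff ?gt_eqF//; ring.
- have har : h < r - a by near: h; apply: nbhs_right_lt; rewrite subr_gt0.
  by rewrite /phi !max_r ?subrr ?mul0r //; lra.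
Unshelve. all: by end_near. Qed.

Lemma lderiv_phi (r a : R) : 0 < a -> lderiv (phi r) a = (r < a)%R%:R.
Proof.
move=> a0; rewrite /lderiv gt_eqF //; apply/cvg_lim => //; apply: cvg_near_cst.
have [ra|ar] := ltP r a; near=> h.
- have h0 : h < 0 by near: h; exact: nbhs_left_lt.
  have hra : r - a < h by near: h; apply: nbhs_left_gt; rewrite subr_lt0.
  by rewrite /phi !max_l; [|lra|lra]; rewrite (_ : a + h - r - (a - r) = h) ?divff ?lt_eqF//; ring.
- have h0 : h < 0 by near: h; exact: nbhs_left_lt.
  by rewrite /phi !max_r ?subrr ?mul0r //; lra.
Unshelve. all: by end_near. Qed.

(* The profit density of the indirect utility [phi t], extended by 0 to
   [t = +oo]; [x] stands for xi_k. *)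
Definition phi_density t a x : R :=
  (if x <= a then (t <= a%:E)%E else (t < a%:E)%E)%:R * (a - x) - excess a t.

Lemma phi_densityy a x : phi_density +oo%E a x = 0.
Proof. by rewrite /phi_density leye_eq ltNge leey /= if_same mul0r subr0. Qed.

Lemma phi_density_lt (r a x : R) : r < a -> phi_density r%:E a x = r - x.
Proof.
move=> ra; rewrite /phi_density lee_fin lte_fin (ltW ra) ra if_same mul1r /=.
by rewrite max_l; lra.
Qed.

Lemma phi_density_eq (a x : R) : phi_density a%:E a x = if x <= a then a - x else 0.
Proof.
rewrite /phi_density lee_fin lte_fin lexx ltxx /= subrr maxxx subr0.
by case: ifP => _; rewrite ?mul1r ?mul0r.
Qed.

Lemma phi_density_gt (r a x : R) : a < r -> phi_density r%:E a x = 0.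
Proof.
move=> ar; rewrite /phi_density lee_fin lte_fin (lt_geF ar) (lt_gtF ar) if_same.
by rewrite mul0r /= max_r ?subr0 //; lra.
Qed.

(** As [t] grows the density is t - x up to [a], the positive part of a - x at [a], and 0
    afterwards. Hence it can only be negative where it is at least L - x, which yields a minorant
    independent of [t]. *)
Lemma phi_density_ge L t a x : (L%:E <= t)%E -> L <= a ->
  - `|phi_density L%:E a x| <= phi_density t a x.
Proof.
case: t => [r||] //; last by rewrite phi_densityy oppr_le0.
rewrite lee_fin => Lr La.
have [ra|ar|<-] := ltgtP r a.
- rewrite !phi_density_lt //; last exact: le_lt_trans ra.
  by have := ler_norm (- (L - x)); rewrite normrN; lra.
- by rewrite (phi_density_gt _ ar) oppr_le0.
- by rewrite (phi_density_eq r); case: ifP => rx; rewrite (@le_trans _ _ 0) // ?oppr_le0 ?subr_ge0.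
Qed.

Lemma phi_density_max L t a x : (0 <= t)%E -> L <= a ->
  phi_density t a x <= phi_density (Order.max t L%:E) a x.
Proof.
case: t => [r||] t0 La; [|by rewrite max_l ?leey|by move: t0].
have [rL|Lr] := ltP r L; last by rewrite max_l // lee_fin.
rewrite max_r; last by rewrite lee_fin ltW.
rewrite (@phi_density_lt r); last exact: lt_le_trans La.
have /predU1P[<-|La'] : (L == a) || (L < a) by rewrite -le_eqVlt.
  2: by rewrite phi_density_lt // lerD2r ltW.
by rewrite phi_density_eq; clear t0; case: (leP x L) => ?; lra.
Qed.

(** The excess terms average to at most [v a], so it remains to compare the number of levels active
    at [a] with N mu. The sign of a - x decides which bound on this number is needed, and the tie
    rule in [phi_density] at a kink equal to [a] is the one that makes that bound true. *)
Lemma sum_phi_density_ge v a mu x L (n : nat) :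
  v 0 = 0 -> {in Rplus &, {homo v : x y / x <= y}} -> 0 <= a -> L <= a ->
  0 <= mu <= 1 -> subgradient v a mu ->
  mu * (a - x) - v a <=
  \sum_(i < n.+1) phi_density (Order.max (kink v (i.+1%:R / n.+1%:R)) L%:E) a x
    / n.+1%:R + `|a - x| / n.+1%:R.
Proof.
move=> v0 vh a0 La /andP[mu0 mu1] va.
set N : R := n.+1%:R; have N0 : 0 < N by rewrite ltr0n.
pose k i := kink v (i.+1%:R / N).
apply: (@le_trans _ _ (\sum_(i < n.+1) phi_density (k i) a x / N + `|a - x| / N));
  last first.
  rewrite lerD2r; apply: ler_sum => i _; rewrite ler_wpM2r ?invr_ge0 ?(ltW N0) //.
  by apply: phi_density_max => //; exact: kink_ge0.
pose b i := if x <= a then (k i <= a%:E)%E else (k i < a%:E)%E.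
have -> : \sum_(i < n.+1) phi_density (k i) a x / N =
    (\sum_(i < n.+1) (b i)%:R) * ((a - x) / N) - \sum_(i < n.+1) excess a (k i) / N.
  rewrite mulr_suml -sumrB; apply: eq_bigr => i _.
  by rewrite /phi_density mulrBl -mulrA.
have Sv : \sum_(i < n.+1) excess a (k i) / N <= v a by exact: sum_excess_kink_le.
suff : mu * (a - x) <= (\sum_(i < n.+1) (b i)%:R) * ((a - x) / N) + `|a - x| / N.
  by move=> H; rewrite addrAC; apply: lerB.
have muE : mu * (a - x) = (N * mu) * ((a - x) / N).
  by field; exact: lt0r_neq0.
have [xa|ax] := leP x a.
(* Nonnegative margin: at least N mu - 1 levels are active, and the missing one costs the error
   term. *)
- rewrite ger0_norm ?subr_ge0 // -lerBlDr muE -[X in _ - X]mul1r -mulrBl ler_wpM2r ?divr_ge0 ?subr_ge0 ?(ltW N0) //.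
  rewrite (le_trans (sum_le_count_ge (N := n.+1) _)) //.
    by rewrite -/N ler_piMr // (ltW N0).
  apply: ler_sum => i _; rewrite ler_nat /b xa.
  have [iN|//] := leP _ (N * mu).
  by rewrite (kink_le a0 va) // ler_pdivrMr // mulrC.
(* Negative margin: at most N mu levels have a kink strictly below [a]. *)
- rewrite -[X in X <= _]addr0 lerD ?divr_ge0 ?(ltW N0) // muE.
  rewrite ler_wnM2r ?pmulr_lle0 ?invr_gt0 ?subr_le0 ?(ltW ax) //.
  apply: (le_trans _ (sum_le_count_le n.+1 _)); last by rewrite mulr_ge0 ?(ltW N0).
  apply: ler_sum => i _; rewrite ler_nat /b leNgt ax /=.
  case kia : (_ < _)%E => //.
  by rewrite mulrC -ler_pdivrMr // (kink_lt va kia).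
Qed.

End PhiDensity.

(** * Auxiliary facts on utilities, layer maximizers, VaR and split integrals *)

Lemma indirect_utilities_phi (R : realType) (t : R) : 0 <= t ->
  indirect_utilities (phi t).
Proof.
move=> t0; split.
- by rewrite /phi max_r //; lra.
- by move=> x y _ _ xy; rewrite /phi le_max2 // lerD2r.
- move=> p x y _ _; rewrite (convRE (phi t x) (phi t y) p).
  have -> : conv p x y = p%:num * (x : R) + unstable.onem p%:num * (y : R).
    exact: convRE.
  have p0 : 0 <= p%:num :> R by [].
  have p1 : 0 <= unstable.onem p%:num :> R by rewrite unstable.onem_ge0.
  have px (z : R) : phi t z >= z - t by rewrite le_max lexx.
  have p2 (z : R) : phi t z >= 0 by rewrite le_max lexx orbT.
  rewrite {1}/phi ge_max; apply/andP; split; last by rewrite addr_ge0 ?mulr_ge0.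
  apply: le_trans (lerD (ler_wpM2l p0 (px x)) (ler_wpM2l p1 (px y))).
  by rewrite /unstable.onem; lra.
- move=> [x y] _ /=; rewrite mul1r /phi.
  have [xt|xt] := leP (x - t) 0; have [yt|yt] := leP (y - t) 0.
  + by rewrite subrr normr0.
  + by rewrite sub0r normrN gtr0_norm // ler_normr; apply/orP; right; lra.
  + by rewrite subr0 gtr0_norm // ler_normr; apply/orP; left; lra.
  + by rewrite opprB addrA subrK.
Qed.

Lemma is_theta_star_fin (R : realType) (B : R -> R) (t : \bar R) (L : R) :
  is_theta_star B t -> (t <= L%:E)%E ->
  [/\ t = (fine t)%:E, 0 <= fine t, fine t <= L
    & forall d, 0 <= d -> B d <= B (fine t)].
Proof.
case=> [[_ ->]|[_ [r -> [r0 Br]]]]; first by rewrite leye_eq.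
by rewrite lee_fin.
Qed.

Lemma excess_ge0 (R : realType) (x : R) d : 0 <= excess x d.
Proof. by case: d => [r||] //=; rewrite le_max lexx orbT. Qed.

Lemma VaR_ge0 d (Omega : measurableType d) (R : realType)
    (P : probability Omega R) (X : {RV P >-> R}) (alpha : R) :
  (alpha%:E < 1 - cdf X 0)%E -> 0 <= VaR alpha X.
Proof.
rewrite -ccdf_1_cdf => aX; rewrite /VaR.
(* On the empty set [inf] takes the default value 0. *)
have [->|/set0P S0] := eqVneq [set x | (ccdf X x <= alpha%:E)%E] set0.
  by rewrite inf0.
apply: lb_le_inf => // x /= xa; rewrite leNgt; apply/negP => x0.
have := lt_le_trans aX (ccdf_nonincreasing X (ltW x0)).
by rewrite ltNge xa.
Qed.

Lemma Rintegral_split d (T : measurableType d) (R : realType)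
    (mu : measure T R) (D A B : set T) (f g h : T -> R) :
  measurable A -> measurable B -> D = A `|` B -> [disjoint A & B] ->
  mu.-integrable A (EFin \o f) -> mu.-integrable B (EFin \o g) ->
  {in A, f =1 h} -> {in B, g =1 h} ->
  mu.-integrable D (EFin \o h) /\
  \int[mu]_(x in A) f x + \int[mu]_(x in B) g x = \int[mu]_(x in D) h x.
Proof.
move=> mA mB -> AB fi gi fh gh.
have hA : mu.-integrable A (EFin \o h).
  by apply: eq_integrable fi => // x xA /=; rewrite fh.
have hB : mu.-integrable B (EFin \o h).
  by apply: eq_integrable gi => // x xB /=; rewrite gh.
have hi : mu.-integrable (A `|` B) (EFin \o h).
  have /integrableP[mhA hAoo] := hA; have /integrableP[mhB hBoo] := hB.
  have mh : measurable_fun (A `|` B) (EFin \o h) by apply/measurable_funU.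
  apply/integrableP; split => //; rewrite ge0_integral_setU //.
    exact: lte_add_pinfty.
  exact: measurableT_comp.
by split => //; rewrite Rintegral_setU // (eq_Rintegral _ fh) (eq_Rintegral _ gh).
Qed.

(** * From menus and utilities to profit densities *)

Section ChangeLossMenus.
Context {R : realType} {K : ptopologicalType} {dO : measure_display}
  {Omega : measurableType dO} {P : probability Omega R}
  (H : (Omega -> R) -> R) (X : K -> {RV P >-> R}) (theta : K -> \bar R).
Notation types := (R * borel K)%type.

(** If the indemnity pays nothing at [a], then [mu = 0] works, since indemnities and costs are
    nonnegative. Otherwise [a] exceeds the deductible, the indemnity lies above its tangent of slope
    lambda at [a], and [mu] is lambda; the margin a - d - H is at most a - xi because [theta k]
    maximizes the layer value. *)
Lemma feasible_subgradient (M : menu) (a : R) (k : K) :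
  (forall d, (0 <= d)%E -> 0 <= H (fun w => excess (X k w) d)) ->
  (forall d, 0 <= d -> layer_value H (X k) d <= layer_value H (X k) (fine (theta k))) ->
  feasible M -> 0 <= a ->
  exists mu, [/\ 0 <= mu <= 1, subgradient (utility M) a mu &
    profit_density H X M (a, k) <= mu * (a - xi H X theta k) - utility M a].
Proof.
move=> H0 Btheta [_ /(_ a k)] Mak a0; have [l01 d0 lv] := Mak a0.
have /andP[l0 l1] := l01; move: d0 lv (H0 _ d0).
rewrite /profit_density /indemnity /=; set l := coinsurance M a k in l01 l0 l1 *.
set v := utility M; set d := deductible M a k => d0 lv Hd.
have [/eqP ad0|ad0] := boolP (excess a d == 0).
  exists 0; split; first by rewrite lexx ler01.
    move=> y y0; rewrite mul0r (le_trans _ (lv y y0)) // ad0 mulr0 subr0.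
    by rewrite mulr_ge0 ?excess_ge0.
  by rewrite ad0 mul0r lerD2r sub0r mulrN oppr_le0 mulr_ge0.
move: d d0 lv Hd ad0 => [r||] //= r0 lv Hd; last by rewrite eqxx.
have [ar|ra] := leP (a - r) 0; first by rewrite eqxx.
move=> _; exists l; split => //.
  move=> y y0; apply: le_trans (lv y y0).
  rewrite (max_l (ltW ra)) -mulrBr ler_wpM2l //.
  have : y - r <= Num.max (y - r) 0 by rewrite le_max lexx.
  by move=> ?; lra.
by rewrite lerD2r ler_wpM2l // /xi opprK -addrA lerD2l; exact: Btheta.
Qed.

Lemma utility_profit_phi (Q : probability types R) (T : set types) (t : R) :
  (forall z, T z -> 0 < z.1) -> utility_profit_defined H X Q T theta (phi t) ->
  let g z := phi_density t%:E z.1 (xi H X theta z.2) in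
  Q.-integrable T (EFin \o g) /\
  utility_profit H X Q T theta (phi t) = \int[Q]_(z in T) g z.
Proof.
move=> T0 [mp mm ip im] g; apply: Rintegral_split mp mm _ _ ip im _ _.
- apply/seteqP; split=> [z Tz|z [] []//].
  by have [] := leP (xi H X theta z.2) z.1; [left|right].
- by apply/disj_setPS => z [[_ /= xz] [_ /=]]; rewrite ltNge xz.
- move=> z; rewrite inE => -[Tz xz].
  by rewrite /g /phi_density xz /density_plus rderiv_phi lee_fin.
- move=> z; rewrite inE => -[Tz xz].
  by rewrite /g /phi_density leNgt xz /= /density_minus lderiv_phi ?lte_fin //; exact: T0.
Qed.

End ChangeLossMenus.

Lemma Rintegral_average_le d (T : measurableType d) (R : realType)
    (mu : measure T R) (D : set T) (g : nat -> T -> R) (m : R) (n : nat) :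
  measurable D ->
  (forall i, mu.-integrable D (EFin \o g i) /\ \int[mu]_(x in D) g i x <= m) ->
  mu.-integrable D (EFin \o (fun x => \sum_(i < n.+1) g i x / n.+1%:R)) /\
  \int[mu]_(x in D) (\sum_(i < n.+1) g i x / n.+1%:R) <= m.
Proof.
move=> mD gm.
have [gi gle] : mu.-integrable D (EFin \o (fun x => \sum_(i < n.+1) g i x)) /\
    \int[mu]_(x in D) (\sum_(i < n.+1) g i x) <= n.+1%:R * m.
  elim: {n}n.+1 => [|n [IHi IHle]].
    split; last by rewrite mul0r; under eq_Rintegral do rewrite big_ord0;
      rewrite Rintegral_cst // mul0r.
    by under eq_fun do rewrite /= big_ord0; exact: integrable0.
  have [gi gle] := gm n.
  split.
    rewrite (_ : EFin \o _ =
        (EFin \o (fun x => \sum_(i < n) g i x)%R) \+ (EFin \o g n))%E.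
      exact: integrableD.
    by apply/funext => x /=; rewrite big_ord_recr.
  under eq_Rintegral do rewrite big_ord_recr.
  by rewrite RintegralD // -natr1 mulrDl mul1r lerD.
have E x : \sum_(i < n.+1) g i x / n.+1%:R = n.+1%:R^-1 * \sum_(i < n.+1) g i x.
  by rewrite -mulr_suml mulrC.
split.
  rewrite (_ : EFin \o _ = fun x => (n.+1%:R^-1)%:E *
      (EFin \o (fun x => \sum_(i < n.+1) g i x)%R) x)%E.
    exact: integrableZl.
  by apply/funext => x /=; rewrite E.
under eq_Rintegral do rewrite E.
by rewrite RintegralZl // mulrC ler_pdivrMr // mulrC.
Qed.

Theorem theorem7p7 (R : realType) (K : ptopologicalType)
    (dO : measure_display) (Omega : measurableType dO) (P : probability Omega R)
    (dom : set (Omega -> R)) (H : (Omega -> R) -> R) (loading : R)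
    (X : K -> {RV P >-> R})
    (Tt : set (R * borel K)) (Qt Q : probability (R * borel K)%type R)
    (theta : K -> \bar R) (L tau : R) :
  polish R K ->
  (forall k, regular_loss (X k)) ->
  cost_functional P dom H loading ->
  (forall k, dom (X k)) ->
  (forall k d, (0 <= d)%E -> dom (fun w => excess (X k w) d)) ->
  (forall k, convex_function (Rplus : set R^o) (fun d => - layer_value H (X k) d)) ->
  (forall k, is_theta_star (layer_value H (X k)) (theta k)) ->
  type_set X Tt ->
  image_law X Tt Qt Q ->
  let T := iota_type X @` Tt in
  let J1 := utility_profit H X Q T theta in
  let J := profit H X Q T in
  L = inf [set a | 0 <= a /\ exists k, T (a, k)] ->
  0 < L ->
  (ereal_sup [set theta k | k in [set: K]] <= L%:E)%E ->
  (forall t, L <= t -> utility_profit_defined H X Q T theta (phi t)) ->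
  L <= tau ->
  (forall t, L <= t -> J1 (phi t) <= J1 (phi tau)) ->
  forall dstar : R -> K -> \bar R,
    (forall a k, tau <= a -> dstar a k = theta k) ->
    (forall a k, 0 <= a < tau -> (0 <= dstar a k)%E) ->
    let Mstar := Menu (phi tau) (optimal_coinsurance H X theta tau) dstar in
    [/\ menus3 H X Q T Mstar,
        forall M, menus3 H X Q T M -> J M <= J Mstar
      & forall a k, 0 <= a ->
          premium Mstar a k = optimal_premium H X theta tau a k].
Proof.
move=> _ _ Hc _ domX _ thP [_ _ _ VT [_ mT]] _ T J1 J LE L0 supL Jdef Ltau tauP.
move=> dstar dge dlt Mstar.
have TL z : T z -> L <= z.1.
  move=> [y Ty <-]; rewrite LE; apply: ge_inf.
    by exists 0 => a [].
  by split; [exact: VaR_ge0 (VT _ Ty)|exists y.2, y].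
have th k : [/\ theta k = (fine (theta k))%:E, 0 <= fine (theta k), fine (theta k) <= L
    & forall d, 0 <= d -> layer_value H (X k) d <= layer_value H (X k) (fine (theta k))].
  apply: is_theta_star_fin => //; apply: le_trans supL.
  by apply: ereal_sup_ubound; exists k.
have H0 k d : (0 <= d)%E -> 0 <= H (fun w => excess (X k w) d).
  by move=> d0; apply: (cost_ge0 Hc (domX k d d0)) => w; exact: excess_ge0.
pose g t (z : R * borel K) := phi_density t z.1 (xi H X theta z.2).
have T0 z : T z -> 0 < z.1 by move=> /TL; exact: lt_le_trans.
have gJ1 t : L <= t -> Q.-integrable T (EFin \o g t%:E) /\
    J1 (phi t) = \int[Q]_(z in T) g t%:E z.
  by move=> Lt; apply: utility_profit_phi => //; exact: Jdef.
have [gLi _] := gJ1 L (lexx L).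
(* The common integrable minorant for both limit arguments below. *)
have gLNi : Q.-integrable T (EFin \o (fun z => - `|g L%:E z|)).
  rewrite (_ : EFin \o _ = \- (EFin \o (Num.norm \o g L%:E)))%E.
    exact/integrableN/integrable_norm.
  exact/funext.
(* The profit of [phi t] tends to 0 as [t] grows. *)
have m0 : 0 <= J1 (phi tau).
  have <- : \int[Q]_(z in T) (0 : R) = 0 by rewrite Rintegral_cst // mul0r.
  apply: (le_Rintegral_approx mT _ gLNi (f_ := fun n => g (L + n%:R)%:E)).
  - exact: integrable0.
  - by move=> n; have [] := gJ1 (L + n%:R); rewrite ?lerDl.
  - by move=> n z Tz; apply: phi_density_ge; rewrite ?lee_fin ?lerDl //; exact: TL.
  (* The density vanishes once L + n > z.1; before that, n + 1 <= z.1 + 1, so the constant divided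
     by n + 1 still dominates the minorant. *)
  - move=> z Tz; exists (`|g L%:E z| * (z.1 + 1)) => n.
    have z1 : 0 <= z.1 + 1 by rewrite addr_ge0 // ltW // T0.
    have [zLn|Lnz] := ltP z.1 (L + n%:R).
      by rewrite /= /g (@phi_density_gt _ (L + n%:R)) // add0r divr_ge0 // mulr_ge0.
    have := @phi_density_ge R L (L + n%:R)%:E z.1 (xi H X theta z.2).
    rewrite lee_fin lerDl ler0n -/(g _ z) -/(g _ z) => /(_ isT (TL z Tz)).
    rewrite lerNl -subr_ge0 opprK => gz; apply: le_trans gz _.
    rewrite addrC lerD2l -mulrA ler_peMr // ler_pdivlMr // mul1r -natr1 lerD2r.
    by apply: le_trans Lnz; rewrite lerDr ltW.
  - move=> n; have [|_ <-] := gJ1 (L + n%:R); first by rewrite lerDl.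
    by apply: tauP; rewrite lerDl.
(* The value +oo occurs for slope levels that the utility never reaches; there the bound is [m0]. *)
have gm t : (L%:E <= t)%E ->
    Q.-integrable T (EFin \o g t) /\ \int[Q]_(z in T) g t z <= J1 (phi tau).
  case: t => [t||] // Lt.
    by have [gi <-] := gJ1 t Lt; split => //; exact: tauP.
  have g0 z : g +oo%E z = 0 by exact: phi_densityy.
  split.
    rewrite (_ : EFin \o _ = cst 0%E); first exact: integrable0.
    by apply/funext => z /=; rewrite g0.
  by under eq_Rintegral do rewrite g0; rewrite Rintegral_cst // mul0r.
have tau0 : 0 < tau by exact: lt_le_trans Ltau.
(* With full coverage above theta_k, the margin a - xi_k minus the rent a - tau leaves tau -
   xi_k. *)
have starE : {in T, profit_density H X Mstar =1 g tau%:E}.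
  move=> [a k]; rewrite inE => Tz; have [tk tk0 tkL Bk] := th k.
  have xiE : xi H X theta k = fine (theta k) + H (fun w => excess (X k w) (theta k)).
    by rewrite {2}tk /xi /layer_value opprB opprK addrC.
  rewrite /profit_density /g /= /optimal_coinsurance.
  have [ta|a_tau|ta] := ltgtP tau a.
  - rewrite phi_density_lt // mul1r (dge _ _ (ltW ta)) xiE {1}tk /= /phi.
    by rewrite !max_l; [lra|lra|lra].
  - by rewrite phi_density_gt // mul0r /phi max_r; lra.
  - rewrite -ta (dge _ _ (lexx _)) phi_density_eq /phi subrr maxxx subr0.
    case: ifP => _; last by rewrite mul0r.
    by rewrite mul1r xiE {1}tk /= max_l; lra.
have Jstar : J Mstar = J1 (phi tau).
  by have [_ ->] := gJ1 tau Ltau; exact: eq_Rintegral.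
split.
- split; last first.
    by have [gi _] := gJ1 tau Ltau; apply: eq_integrable gi => // z zT /=; rewrite starE.
  split; first exact/indirect_utilities_phi/ltW.
  move=> a k a0; have [tk tk0 tkL Bk] := th k; split.
  + rewrite /= /optimal_coinsurance.
    by case: ifP => _; [|case: ifP => _; [case: ifP => _|]]; rewrite ?lexx ?ler01.
  + rewrite /=; have [ta|at_] := leP tau a; first by rewrite dge // tk lee_fin.
    by apply: dlt; rewrite a0.
  + move=> y y0; rewrite /indemnity /= /optimal_coinsurance.
    have ptau z : 0 <= phi tau z by rewrite le_max lexx orbT.
    (* Since theta_k <= L <= tau, lowering the deductible from tau to theta_k raises the payment at
       [y] by at most tau - theta_k, and the payment at [a] by exactly that. *)
    have buy : tau <= a -> 1 * excess y (dstar a k) - 1 * excess a (dstar a k) <=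
        phi tau y - phi tau a.
      move=> ta; rewrite (dge _ _ ta) tk /= /phi !mul1r.
      rewrite (@max_l _ _ (a - _)); last lra.
      rewrite (@max_l _ _ (a - tau)); last lra.
      have : Num.max (y - fine (theta k)) 0 <=
          Num.max (y - tau) 0 + (tau - fine (theta k)).
        have := ptau y; have : y - tau <= phi tau y by rewrite le_max lexx.
        by rewrite /phi ge_max => *; apply/andP; split; lra.
      by move=> ?; lra.
    have pass : a <= tau -> 0 * excess y (dstar a k) - 0 * excess a (dstar a k) <=
        phi tau y - phi tau a.
      by move=> at_; rewrite !mul0r {2}/phi (@max_r _ _ (a - _)) ?subr0 ?ptau //; lra.
    (* At [a = tau] both contracts are incentive compatible, so the tie may be broken by the sign of
       the margin. *)
    have [ta|ta|ta] := ltgtP tau a; [exact/buy/ltW|exact/pass/ltW|].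
    by case: ifP => _; [apply: buy|apply: pass]; rewrite ta.
- move=> M [Mf Mi]; rewrite Jstar; have [[v0 vh _ _] _] := Mf.
  pose k n i := kink (utility M) (i.+1%:R / n.+1%:R).
  pose h n z := \sum_(i < n.+1) g (Order.max (k n i) L%:E) z / n.+1%:R.
  have kL n i : (L%:E <= Order.max (k n i) L%:E)%E by rewrite le_max lexx orbT.
  have hm n : Q.-integrable T (EFin \o h n) /\ \int[Q]_(z in T) h n z <= J1 (phi tau).
    apply: (Rintegral_average_le (g := fun i => g (Order.max (k n i) L%:E))) => // i.
    exact: gm.
  apply: (le_Rintegral_approx mT Mi gLNi (f_ := h)).
  + by move=> n; case: (hm n).
  + move=> n z Tz.
    (* The minorant is spread evenly over the averaged terms, each of which has its kink at or above
       [L]. *)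
    have -> : - `|g L%:E z| = \sum_(i < n.+1) - `|g L%:E z| / n.+1%:R.
      by rewrite sumr_const card_ord -[RHS]mulr_natl mulrC divfK // pnatr_eq0.
    apply: ler_sum => i _; rewrite ler_wpM2r ?invr_ge0 //.
    by apply: phi_density_ge; [exact: kL|exact: TL].
  + move=> [a x] Tz; have a0 := ltW (T0 _ Tz); have [_ _ _ Bk] := th x.
    have [mu [mu01 va le_mu]] := feasible_subgradient (H0 x) Bk Mf a0.
    exists `|a - xi H X theta x| => n; apply: le_trans le_mu _.
    exact: (sum_phi_density_ge (xi H X theta x) n v0 vh a0 (TL _ Tz) mu01 va).
  + by move=> n; case: (hm n).
- move=> a k a0; have [tk tk0 tkL _] := th k.
  rewrite /premium /indemnity /= /optimal_coinsurance /optimal_premium.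
  have [ta|ta|ta] := ltgtP tau a.
  + by rewrite (dge _ _ (ltW ta)) tk /= /phi !max_l; lra.
  + by rewrite mul0r /phi max_r; lra.
  + rewrite (dge a) ?ta // tk -ta /= /phi subrr maxxx.
    by case: ifP => _; rewrite ?mul0r ?subr0 // mul1r max_l //; lra.
Qed.
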